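(* Let $(R,+,\cdot,0,1,<)$ be a non-Archimedean real closed field. Assume that $R$ admits an integer part whose non-negative cone is a model of $I\Delta_0+EXP$. Then $R$ admits a left exponential function, i.e. $R$ admits left exponentiation.
   Context: Integer part: an integer part of an ordered field $R$ is a discretely ordered subring $Z\subseteq R$ such that for every $r\in R$ there is $z\in Z$ with $z\le r<z+1$. Its non-negative cone is $Z^{\ge0}$, regarded as a structure in the language $\{+,\cdot,0,1,<\}$. $I\Delta_0$ is the theory of non-negative cones of discretely ordered commutative rings with $1$ together with the induction axiom for every bounded ($\Delta_0$) formula of $\{+,\cdot,0,1,<\}$, i.e. every formula in which all quantifiers are bounded by terms of the language. There is a $\Delta_0$-formula $E(x,y)$ defining the graph of $y=2^x$ in $\mathbb{N}$ for which $I\Delta_0$ proves the usual properties of exponentiation other than totality: $E(0,1)$ and $E(1,2)$; for each $x$ there is at most one $y$ with $E(x,y)$; $x\ge1\wedge E(x,y)\to y\ge x+1$; $E(a,c)\wedge E(b,d)\to E(a+b,cd)$; $E(a,c)\wedge E(b,d)\wedge a<b\to c<d$; and for every $x\ge1$ there is a unique $y$ such that for some $z$, $E(y,z)$ and $z\le x<2z$. Fix such a formula. $EXP$ is the axiom $\forall x\,\exists! y\,E(x,y)$, and $I\Delta_0+EXP$ is $I\Delta_0$ together with $EXP$. Natural valuation: for non-zero $x,y\in R$ put $x\sim y$ if there is $n\in\mathbb{N}$ with $n|x|\ge|y|$ and $n|y|\ge|x|$; let $v(x)$ be the $\sim$-class of $x$, with the classes ordered by $v(y)<v(x)$ iff $n|x|<|y|$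 for all $n\in\mathbb{N}$, with addition $v(x)+v(y)=v(xy)$, and $v(0)=\infty$. Put $R_v=\{a\in R:v(a)\ge0\}$ (the convex hull of $\mathbb{Z}$ in $R$) and $\mathcal{U}_v^{>0}=\{a\in R:a>0,\ v(a)=0\}$. Left exponentiation: the ordered groups $(R,+,0,<)$ and $(R^{>0},\cdot,1,<)$ are divisible, i.e. ordered $\mathbb{Q}$-vector spaces. $R$ admits left exponentiation if there is an order preserving group isomorphism (a left exponential function) from some ($\mathbb{Q}$-vector space) complement $A$ of $R_v$ in $(R,+,0,<)$ onto some ($\mathbb{Q}$-vector space) complement $B$ of $\mathcal{U}_v^{>0}$ in $(R^{>0},\cdot,1,<)$. *)

(* Defs.v *)
From HB Require Import structures.
From mathcomp Require Import all_boot all_order all_algebra.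
From mathcomp Require Import boolp classical_sets functions.

Set Implicit Arguments.
Unset Strict Implicit.
Unset Printing Implicit Defensive.

Import Order.TTheory GRing.Theory Num.Theory.
Local Open Scope classical_set_scope.
Local Open Scope ring_scope.

(** * First-order arithmetic *)

(* Variables are de Bruijn indices.  The primitive connectives are falsity,
   implication and the universal quantifier, the others being their classical
   abbreviations. *)
Inductive aterm : Type :=
| Var of nat
| Zero
| One
| Add of aterm & aterm
| Mul of aterm & aterm.

Inductive aform : Type :=
| Eq of aterm & aterm
| Lt of aterm & aterm
| Bot
| Imp of aform & aform
| All of aform.

Definition Neg (p : aform) : aform := Imp p Bot.
Definition And (p q : aform) : aform := Neg (Imp p (Neg q)).
Definition Or (p q : aform) : aform := Imp (Neg p) q.
Definition Ex (p : aform) : aform := Neg (All (Neg p)).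
Definition Le (s t : aterm) : aform := Or (Lt s t) (Eq s t).

Fixpoint tsubst (sigma : nat -> aterm) (t : aterm) : aterm :=
  match t with
  | Var n => sigma n
  | Zero => Zero
  | One => One
  | Add s u => Add (tsubst sigma s) (tsubst sigma u)
  | Mul s u => Mul (tsubst sigma s) (tsubst sigma u)
  end.

Definition tlift : aterm -> aterm := tsubst (fun n => Var n.+1).

Definition scons (T : Type) (a : T) (f : nat -> T) (n : nat) : T :=
  if n is k.+1 then f k else a.

Fixpoint fsubst (sigma : nat -> aterm) (p : aform) : aform :=
  match p with
  | Eq s t => Eq (tsubst sigma s) (tsubst sigma t)
  | Lt s t => Lt (tsubst sigma s) (tsubst sigma t)
  | Bot => Bot
  | Imp q r => Imp (fsubst sigma q) (fsubst sigma r)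
  | All q => All (fsubst (scons (Var 0) (fun n => tlift (sigma n))) q)
  end.

Definition flift : aform -> aform := fsubst (fun n => Var n.+1).

Definition finst (t : aterm) : aform -> aform := fsubst (scons t Var).

(* In the uniqueness clause 0 is the new witness and 1 the one bound by [Ex]. *)
Definition ExUnique (p : aform) : aform :=
  Ex (And p
          (All (Imp (fsubst (scons (Var 0) (fun n => Var n.+2)) p)
                    (Eq (Var 0) (Var 1))))).

Fixpoint tvars_below (k : nat) (t : aterm) : bool :=
  match t with
  | Var n => (n < k)%N
  | Zero | One => true
  | Add s u | Mul s u => tvars_below k s && tvars_below k u
  end.

Fixpoint fvars_below (k : nat) (p : aform) : bool :=
  match p with
  | Eq s t | Lt s t => tvars_below k s && tvars_below k t
  | Bot => true
  | Imp q r => fvars_below k q && fvars_below k r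
  | All q => fvars_below k.+1 q
  end.

(* The bound [t] may not mention the bound variable, hence the lifting.
   A bound [x <= t] is the bound [x < t + 1]. *)
Inductive Delta0 : aform -> Prop :=
| Delta0_Eq s t : Delta0 (Eq s t)
| Delta0_Lt s t : Delta0 (Lt s t)
| Delta0_Bot : Delta0 Bot
| Delta0_Imp p q : Delta0 p -> Delta0 q -> Delta0 (Imp p q)
| Delta0_All t p :
    Delta0 p -> Delta0 (All (Imp (Lt (Var 0) (tlift t)) p))
| Delta0_Ex t p :
    Delta0 p -> Delta0 (Ex (And (Lt (Var 0) (tlift t)) p)).

(** ** Provability *)

(* A theory is a set of formulas whose free variables are read as universally
   quantified, so that generalization is unrestricted. *)
Definition theory := set aform.

Inductive proves (T : theory) : aform -> Prop :=
| Pr_axiom p : T p -> proves T p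
| Pr_K p q : proves T (Imp p (Imp q p))
| Pr_S p q r :
    proves T (Imp (Imp p (Imp q r)) (Imp (Imp p q) (Imp p r)))
| Pr_DN p : proves T (Imp (Neg (Neg p)) p)
| Pr_inst p t : proves T (Imp (All p) (finst t p))
| Pr_dist p q : proves T (Imp (All (Imp p q)) (Imp (All p) (All q)))
| Pr_vacuous p : proves T (Imp p (All (flift p)))
| Pr_refl t : proves T (Eq t t)
| Pr_leibniz p s t : proves T (Imp (Eq s t) (Imp (finst s p) (finst t p)))
| Pr_MP p q : proves T (Imp p q) -> proves T p -> proves T q
| Pr_gen p : proves T p -> proves T (All p).

(** ** Structures *)

Record structure : Type := Structure {
  carrier :> Type;
  s_zero : carrier;
  s_one : carrier;
  s_add : carrier -> carrier -> carrier;
  s_mul : carrier -> carrier -> carrier;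
  s_lt : carrier -> carrier -> Prop
}.

Fixpoint teval (M : structure) (e : nat -> M) (t : aterm) : M :=
  match t with
  | Var n => e n
  | Zero => s_zero M
  | One => s_one M
  | Add s u => s_add (teval e s) (teval e u)
  | Mul s u => s_mul (teval e s) (teval e u)
  end.

Fixpoint sat (M : structure) (e : nat -> M) (p : aform) : Prop :=
  match p with
  | Eq s t => teval e s = teval e t
  | Lt s t => s_lt (teval e s) (teval e t)
  | Bot => False
  | Imp q r => sat e q -> sat e r
  | All q => forall a : M, sat (scons a e) q
  end.

Definition valid (M : structure) (p : aform) : Prop :=
  forall e : nat -> M, sat e p.

Definition models (M : structure) (T : theory) : Prop :=
  forall p, T p -> valid M p.

Definition nat_structure : structure :=
  @Structure nat 0%N 1%N addn muln (fun x y => (x < y)%N).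

(** ** Discretely ordered rings and integer parts *)

Record discrete_subring (D : realDomainType) (Z : set D) : Prop := {
  discrete_subring_closed : subring_closed (mem Z);
  discrete_subring_ge1 : forall z, z \in Z -> 0 < z -> 1 <= z
}.

Section NonnegCone.
Variables (D : realDomainType) (Z : set D) (HZ : discrete_subring Z).

Definition cone_type : Type := {x : D | (x \in Z) && (0 <= x)}.

Fact cone_zero_subproof : ((0 : D) \in Z) && (0 <= (0 : D)).
Proof.
case: (discrete_subring_closed HZ) => Z1 ZB _.
by rewrite lexx andbT; move: (ZB _ _ Z1 Z1); rewrite subrr.
Qed.

Fact cone_one_subproof : ((1 : D) \in Z) && (0 <= (1 : D)).
Proof. by case: (discrete_subring_closed HZ) => Z1 _ _; rewrite ler01 andbT. Qed.

Fact cone_add_subproof (x y : cone_type) :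
  (sval x + sval y \in Z) && (0 <= sval x + sval y).
Proof.
case: x y => [x /andP[Zx x0]] [y /andP[Zy y0]] /=; rewrite addr_ge0// andbT.
case: (discrete_subring_closed HZ) => _ ZB _.
have /andP[Z0 _] := cone_zero_subproof.
by have := ZB _ _ Zx (ZB _ _ Z0 Zy); rewrite sub0r opprK.
Qed.

Fact cone_mul_subproof (x y : cone_type) :
  (sval x * sval y \in Z) && (0 <= sval x * sval y).
Proof.
case: x y => [x /andP[Zx x0]] [y /andP[Zy y0]] /=; rewrite mulr_ge0// andbT.
by case: (discrete_subring_closed HZ) => _ _; apply.
Qed.

Definition nonneg_cone : structure :=
  @Structure cone_type
    (exist _ 0 cone_zero_subproof)
    (exist _ 1 cone_one_subproof)
    (fun x y => exist _ (sval x + sval y) (cone_add_subproof x y))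
    (fun x y => exist _ (sval x * sval y) (cone_mul_subproof x y))
    (fun x y => sval x < sval y).

End NonnegCone.

Definition integer_part (R : realDomainType) (Z : set R) : Prop :=
  discrete_subring Z /\
  forall r : R, exists2 z, z \in Z & z <= r < z + 1.

(** ** Bounded arithmetic *)

(* Discretely ordered rings have no zero divisors, so every one of them is,
   as the improper subring of itself, among the [Z] below. *)
Definition nonneg_cone_theory : theory :=
  [set p | forall (D : realDomainType) (Z : set D) (HZ : discrete_subring Z),
             valid (nonneg_cone HZ) p].

(* Induction on the variable 0, the other free variables being parameters. *)
Definition induction_axiom (p : aform) : aform :=
  Imp (finst Zero p)
    (Imp (All (Imp p
                   (fsubst (scons (Add (Var 0) One) (fun n => Var n.+1)) p)))
         (All p)).

Definition IDelta0 : theory :=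
  nonneg_cone_theory `|` [set induction_axiom p | p in Delta0].

(* The formula E(s, t), for E with free variables 0 and 1. *)
Definition at2 (E : aform) (s t : aterm) : aform :=
  fsubst (scons s (scons t Var)) E.

Definition Two : aterm := Add One One.

Record exp_formula (E : aform) : Prop := {
  expE_delta0 : Delta0 E;
  expE_vars : fvars_below 2 E;
  expE_nat : forall e : nat -> nat_structure,
    sat e E <-> e 1%N = (2 ^ e 0 :> nat)%N;
  expE_01 : proves IDelta0 (at2 E Zero One);
  expE_12 : proves IDelta0 (at2 E One Two);
  expE_fun : proves IDelta0
    (let x := Var 0 in let y := Var 1 in let y' := Var 2 in
     Imp (And (at2 E x y) (at2 E x y')) (Eq y y'));
  expE_ge : proves IDelta0
    (let x := Var 0 in let y := Var 1 in
     Imp (And (Le One x) (at2 E x y)) (Le (Add x One) y));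
  expE_add : proves IDelta0
    (let a := Var 0 in let b := Var 1 in let c := Var 2 in let d := Var 3 in
     Imp (And (at2 E a c) (at2 E b d)) (at2 E (Add a b) (Mul c d)));
  expE_lt : proves IDelta0
    (let a := Var 0 in let b := Var 1 in let c := Var 2 in let d := Var 3 in
     Imp (And (And (at2 E a c) (at2 E b d)) (Lt a b)) (Lt c d));
  expE_log : proves IDelta0
    (Imp (Le One (Var 0))
         (ExUnique
            (let x := Var 2 in let y := Var 1 in let z := Var 0 in
             Ex (And (at2 E y z) (And (Le z x) (Lt x (Mul Two z)))))))
}.

Definition EXP (E : aform) : aform :=
  All (ExUnique (at2 E (Var 1) (Var 0))).

Definition IDelta0_EXP (E : aform) : theory := IDelta0 `|` [set EXP E].

(** * Natural valuation and left exponentiation *)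

Section LeftExponentiation.
Variable R : rcfType.
Implicit Types (A B V U : set R) (f : R -> R).

Definition arch_equiv (x y : R) : Prop :=
  exists n : nat, `|y| <= `|x| *+ n /\ `|x| <= `|y| *+ n.

(* The value of x is its class; the class of 0, which is {0}, plays the role
   of infinity. *)
Definition nat_val (x : R) : set R := [set y | arch_equiv x y].

(* v(y) < v(x) *)
Definition nat_val_lt (y x : R) : Prop := forall n : nat, `|x| *+ n < `|y|.

(* The neutral element of the value group is v(1). *)
Definition val_ring : set R :=
  [set a | nat_val_lt 1 a \/ nat_val a = nat_val 1].

Definition pos_units : set R := [set a | 0 < a /\ nat_val a = nat_val 1].

Definition add_complement A V : Prop :=
  [/\ zmod_closed (mem A),
      forall (q : rat) x, x \in A -> ratr q * x \in A,
      A `&` V = [set 0] &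
      [set a + v | a in A & v in V] = setT].

(* y is the image of x under the action of the scalar q on the multiplicative
   group of positive elements, that is, y = x ^ q. *)
Definition is_ratpow (x : R) (q : rat) (y : R) : Prop :=
  0 < y /\ y ^ denq q = x ^ numq q.

Definition mul_complement B U : Prop :=
  [/\ B `<=` [set b | 0 < b] /\ divr_closed (mem B),
      forall (q : rat) x y, x \in B -> is_ratpow x q y -> y \in B,
      B `&` U = [set 1] &
      [set b * u | b in B & u in U] = [set x | 0 < x]].

Definition left_exponential A B f : Prop :=
  [/\ add_complement A val_ring,
      mul_complement B pos_units,
      set_bij A B f,
      {in A &, {morph f : x y / x + y >-> x * y}} &
      {in A &, {homo f : x y / x < y}}].

Definition admits_left_exponentiation : Prop :=
  exists A B f, left_exponential A B f.

End LeftExponentiation.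

(* Main.v *)
(* Let [Z] be the integer part.  By [EXP], [2 ^ _] is total on the non-negative
   cone of [Z]; it extends to [Z] by inverses and, [R] being real closed, to the
   divisible hull of [Z] by roots, as an order preserving homomorphism into the
   positive elements.  The finite elements of the hull are the rationals, and
   the hull meets every class of [R] modulo finite elements; so a rational
   complement [A] of the rationals in the hull is a complement of the valuation
   ring in [R].  Since every [r > 0] lies between some [2 ^ x] and [2 * 2 ^ x],
   the image of [A] under [2 ^ _] is a complement of the positive units. *)
Require Import Defs.
From mathcomp Require Import all_boot all_order all_algebra.
From mathcomp Require Import boolp classical_sets functions.
From mathcomp Require Import ring.

Set Implicit Arguments.
Unset Strict Implicit.
Unset Printing Implicit Defensive.

Import Order.TTheory GRing.Theory Num.Theory.

(** * Semantics of substitution, the defined connectives, and soundness *)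

Lemma teval_tsubst (M : structure) (e : nat -> M) (sigma : nat -> aterm) t :
  teval e (tsubst sigma t) = teval (fun n => teval e (sigma n)) t.
Proof. by elim: t => //= s -> u ->. Qed.

Lemma sat_fsubst (M : structure) p (e : nat -> M) (sigma : nat -> aterm) :
  sat e (fsubst sigma p) <-> sat (fun n => teval e (sigma n)) p.
Proof.
elim: p e sigma => [s t|s t||q IHq r IHr|q IHq] e sigma //=.
- by rewrite !teval_tsubst.
- by rewrite !teval_tsubst.
- by split=> qr /IHq/qr/IHr.
- have env a : (fun n => teval (scons a e)
      (scons (Var 0) (fun k => tlift (sigma k)) n)) =
      scons a (fun n => teval e (sigma n)).
    by apply: funext => -[|n] //=; rewrite teval_tsubst.
  by split=> H a; [rewrite -env; apply/IHq|apply/IHq; rewrite env].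
Qed.

Lemma teval_vars_below (M : structure) k t (e e' : nat -> M) :
  tvars_below k t -> (forall n, n < k -> e n = e' n) -> teval e t = teval e' t.
Proof.
move=> + ee'.
elim: t => [n /ee'|//|//|s IHs u IHu|s IHs u IHu] //= /andP[ks ku];
  by rewrite IHs ?IHu.
Qed.

Lemma sat_vars_below (M : structure) p k (e e' : nat -> M) :
  fvars_below k p -> (forall n, n < k -> e n = e' n) -> sat e p <-> sat e' p.
Proof.
elim: p k e e' => [s t|s t||q IHq r IHr|q IHq] k e e' //=.
- by case/andP=> ks kt ee'; rewrite !(teval_vars_below _ ee').
- by case/andP=> ks kt ee'; rewrite !(teval_vars_below _ ee').
- case/andP=> kq kr ee'; have [qq' rr'] := (IHq _ _ _ kq ee', IHr _ _ _ kr ee').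
  by split=> qr /qq'/qr/rr'.
- move=> kq ee'.
  have env a : sat (scons a e) q <-> sat (scons a e') q.
    by apply: (IHq k.+1) => // -[|n] //= /ee'.
  by split=> H a; apply/env.
Qed.

Section Satisfaction.
Variable M : structure.
Implicit Types (e : nat -> M) (p q : aform).

Lemma sat_And e p q : sat e (And p q) <-> sat e p /\ sat e q.
Proof.
split=> [/= H|[ep eq] /= /(_ ep) /(_ eq)//].
by split; apply: contrapT => nH; apply: H => ep // eq; exact: nH.
Qed.

Lemma sat_Or e p q : sat e (Or p q) <-> sat e p \/ sat e q.
Proof.
split=> [/= H|[ep|eq] //=].
by have [ep|/H eq] := pselect (sat e p); [left|right].
Qed.

Lemma sat_Ex e p : sat e (Ex p) <-> exists a, sat (scons a e) p.
Proof.
split=> [/= H|[a pa] /= /(_ a pa)//].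
by apply: contrapT => /forallNP.
Qed.

Lemma sat_Le e s t :
  sat e (Le s t) <-> s_lt (teval e s) (teval e t) \/ teval e s = teval e t.
Proof. exact: sat_Or. Qed.

Lemma sat_ExUnique e p : sat e (ExUnique p) <->
  exists2 a, sat (scons a e) p & forall b, sat (scons b e) p -> b = a.
Proof.
have env a b : (fun n => teval (scons b (scons a e))
    (scons (Var 0) (fun k => Var k.+2) n)) = scons b e.
  by apply: funext => -[|n].
split=> [/sat_Ex[a /sat_And[pa H]]|[a pa H]].
  by exists a => // b pb; apply: (H b); apply/sat_fsubst; rewrite env.
apply/sat_Ex; exists a; apply/sat_And; split=> // b /sat_fsubst.
by rewrite env => /H.
Qed.

End Satisfaction.

Lemma sat_finst (M : structure) (e : nat -> M) t p :
  sat e (finst t p) <-> sat (scons (teval e t) e) p.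
Proof.
have env : (fun n => teval e (scons t Var n)) = scons (teval e t) e.
  by apply: funext => -[|n].
by split=> [/sat_fsubst|H]; last apply/sat_fsubst; rewrite env.
Qed.

(** Induction on the derivation, for all environments at once, which is what generalization needs;
    the double negation axiom uses classical logic in the metatheory. *)
Lemma soundness (M : structure) (T : theory) p :
  models M T -> proves T p -> valid M p.
Proof.
move=> MT; elim=> {p} [p Tp|p q|p q r|p|p t|p q|p|t|p s t
  |p q _ IHpq _ IHp|p _ IHp] e /=.
- exact: MT.
- by [].
- by move=> pqr pq ep; apply: pqr => //; apply: pq.
- exact: contrapT.
- by move=> H; apply/sat_finst.
- by move=> pq H a; apply: pq.
- by move=> H a; apply/sat_fsubst.
- by [].
- by move=> st /sat_finst; rewrite st => /sat_finst.
- exact: (IHpq e (IHp e)).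
- by move=> a; apply: IHp.
Qed.

(** * Exponentiation inside a model *)

Section ModelExponential.
Variables (M : structure) (E : aform).
Hypothesis HE : exp_formula E.
Hypothesis ME : models M (IDelta0_EXP E).

(** Only variables 0 and 1 occur free in [E], so the zeros padding the environment are arbitrary;
    [sat_at2] relies on this. *)
Definition model_exp (x y : M) : Prop :=
  sat (scons x (scons y (fun=> s_zero M))) E.

Lemma sat_at2 (e : nat -> M) s t :
  sat e (at2 E s t) <-> model_exp (teval e s) (teval e t).
Proof.
have env n : n < 2 -> teval e (scons s (scons t Var) n) =
    scons (teval e s) (scons (teval e t) (fun=> s_zero M)) n.
  by case: n => [|[|]].
have H := sat_vars_below (expE_vars HE) env.
by split=> [/sat_fsubst/H|/H] ?; last apply/sat_fsubst.
Qed.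

Lemma model_valid p : proves IDelta0 p -> valid M p.
Proof. by apply: soundness => q IDq; apply: ME; left. Qed.

Lemma model_valid_imp p q (e : nat -> M) :
  proves IDelta0 (Imp p q) -> sat e p -> sat e q.
Proof. by move=> /model_valid; apply. Qed.

(** This is where the axiom [EXP E] enters; the remaining properties come from [IDelta0] by
    soundness. *)
Lemma model_exp_ex x : exists2 y, model_exp x y &
  forall y', model_exp x y' -> y' = y.
Proof.
have /(_ (fun=> s_zero M) x)/sat_ExUnique[y /sat_at2 xy H] :=
  ME (or_intror erefl : IDelta0_EXP E _).
by exists y => // y' xy'; apply: H; apply/sat_at2.
Qed.

Lemma model_exp01 : model_exp (s_zero M) (s_one M).
Proof.
exact: (iffLR (sat_at2 _ _ _) (model_valid (expE_01 HE) (fun=> s_zero M))).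
Qed.

Lemma model_exp12 : model_exp (s_one M) (s_add (s_one M) (s_one M)).
Proof.
exact: (iffLR (sat_at2 _ _ _) (model_valid (expE_12 HE) (fun=> s_zero M))).
Qed.

Let env a b c d : nat -> M :=
  scons a (scons b (scons c (scons d (fun=> s_zero M)))).

Lemma model_expD a b c d :
  model_exp a c -> model_exp b d -> model_exp (s_add a b) (s_mul c d).
Proof.
move=> ac bd.
apply/(sat_at2 (env a b c d) (Add (Var 0) (Var 1)) (Mul (Var 2) (Var 3))).
by apply: (model_valid_imp (expE_add HE)); apply/sat_And; split; apply/sat_at2.
Qed.

Lemma model_exp_lt a b c d :
  model_exp a c -> model_exp b d -> s_lt a b -> s_lt c d.
Proof.
move=> ac bd ab; apply: (@model_valid_imp _ _ (env a b c d) (expE_lt HE)).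
by apply/sat_And; split=> //; apply/sat_And; split; apply/sat_at2.
Qed.

Lemma model_exp_log x : s_lt (s_one M) x \/ s_one M = x ->
  exists y z, [/\ model_exp y z, s_lt z x \/ z = x &
    s_lt x (s_mul (s_add (s_one M) (s_one M)) z)].
Proof.
move=> x1; have /sat_ExUnique[] :=
  model_valid_imp (expE_log HE) (iffRL (sat_Le (fun=> x) One (Var 0)) x1).
move=> y /sat_Ex[z /sat_And[/sat_at2 yz /sat_And[/sat_Le zx xz]]] _.
by exists y, z.
Qed.

End ModelExponential.

Local Open Scope ring_scope.
Local Open Scope classical_set_scope.

(** * Discretely ordered subrings *)

Section DiscreteSubring.
Variables (D : realDomainType) (Z : set D).
Hypothesis HZ : discrete_subring Z.

Lemma discrete_subring1 : 1 \in Z.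
Proof. by case: (discrete_subring_closed HZ). Qed.

Lemma discrete_subringB x y : x \in Z -> y \in Z -> x - y \in Z.
Proof. by case: (discrete_subring_closed HZ) => _ + _; apply. Qed.

Lemma discrete_subring0 : 0 \in Z.
Proof. by rewrite -(subrr 1) discrete_subringB// discrete_subring1. Qed.

Lemma discrete_subringN x : x \in Z -> - x \in Z.
Proof. by rewrite -(sub0r x); exact/discrete_subringB/discrete_subring0. Qed.

Lemma discrete_subringD x y : x \in Z -> y \in Z -> x + y \in Z.
Proof.
by move=> Zx Zy; rewrite -(opprK y) discrete_subringB// discrete_subringN.
Qed.

Lemma discrete_subring_succ x y : x \in Z -> y \in Z -> x < y -> x + 1 <= y.
Proof.
move=> Zx Zy xy; rewrite addrC -lerBrDr.
by apply: (discrete_subring_ge1 HZ); rewrite ?subr_gt0// discrete_subringB.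
Qed.

(** A non-zero element of this kind is at least 1 by discreteness, so subtracting 1 lowers the
    bound. Hence the finite elements of an integer part are standard. *)
Lemma discrete_subring_nat x n :
  x \in Z -> 0 <= x <= n%:R -> exists m : nat, x = m%:R.
Proof.
elim: n x => [|n IHn] x Zx /andP[x0 xn].
  by exists 0%N; apply/eqP; rewrite eq_le x0 xn.
have [->|x_neq0] := eqVneq x 0; first by exists 0%N.
have x1 : 1 <= x.
  by apply: (discrete_subring_ge1 HZ); rewrite // lt_def x_neq0.
have [||m xm] := IHn (x - 1).
- exact/discrete_subringB/discrete_subring1.
- by rewrite subr_ge0 x1 lerBlDr natr1.
- by exists m.+1; rewrite -natr1 -xm subrK.
Qed.

End DiscreteSubring.

(** * Exponentiation transferred from the cone to ring elements *)

Section ConeExponential.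
Variables (D : realDomainType) (Z : set D) (HZ : discrete_subring Z).
Variable E : aform.
Hypothesis HE : exp_formula E.
Hypothesis ME : models (nonneg_cone HZ) (IDelta0_EXP E).

(** Stated on the ring itself, so that subtraction and division are available without carrying
    membership proofs. *)
Definition cone_exp (a c : D) : Prop :=
  exists x y : nonneg_cone HZ,
    [/\ sval x = a, sval y = c & model_exp E x y].

Lemma cone_inj (x y : nonneg_cone HZ) : sval x = sval y -> x = y.
Proof. exact: val_inj. Qed.

Lemma cone_exp_dom a c : cone_exp a c -> (a \in Z) && (0 <= a).
Proof. by move=> [x [y [<- _ _]]]; exact: (valP x). Qed.

Lemma cone_exp_ex a : a \in Z -> 0 <= a -> exists c, cone_exp a c.
Proof.
move=> Za a0; have Pa : (a \in Z) && (0 <= a) by rewrite Za.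
have [y xy _] := model_exp_ex HE ME (exist _ a Pa).
by exists (sval y), (exist _ a Pa), y.
Qed.

Lemma cone_exp_fun a c c' : cone_exp a c -> cone_exp a c' -> c = c'.
Proof.
move=> [x [y [<- <- xy]]] [x' [y' [/cone_inj -> <- xy']]].
have [z _ H] := model_exp_ex HE ME x.
by rewrite (H _ xy) (H _ xy').
Qed.

Lemma cone_exp0 : cone_exp 0 1.
Proof. by exists (s_zero _), (s_one _); split=> //; exact: model_exp01. Qed.

Lemma cone_exp1 : cone_exp 1 2.
Proof. by do 2!eexists; split; last exact: (model_exp12 HE ME). Qed.

Lemma cone_expD a b c d :
  cone_exp a c -> cone_exp b d -> cone_exp (a + b) (c * d).
Proof.
move=> [x [y [<- <- xy]]] [x' [y' [<- <- xy']]].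
by do 2!eexists; split; last exact: (model_expD HE ME xy xy').
Qed.

Lemma cone_exp_lt a b c d :
  cone_exp a c -> cone_exp b d -> a < b -> c < d.
Proof.
move=> [x [y [<- <- xy]]] [x' [y' [<- <- xy']]].
exact: (model_exp_lt HE ME xy xy').
Qed.

Lemma cone_exp_log x : x \in Z -> 1 <= x ->
  exists a c, [/\ cone_exp a c, c \in Z, c <= x & x < 2 * c].
Proof.
move=> Zx x1.
have Px : (x \in Z) && (0 <= x) by rewrite Zx (le_trans ler01).
have [|a [c [ac cx xc]]] :=
    model_exp_log HE ME (x := exist _ x Px : nonneg_cone HZ).
  move: x1; rewrite le_eqVlt => /predU1P[x1|x1]; [right|by left].
  exact: cone_inj.
exists (sval a), (sval c); split=> //; first by exists a, c.
  by case/andP: (valP c).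
by case: cx => [/ltW|->].
Qed.

Lemma cone_exp_gt0 a c : cone_exp a c -> 0 < c.
Proof.
move=> ac; have /andP[_] := cone_exp_dom ac.
rewrite le_eqVlt => /predU1P[a0|a0]; last first.
  exact: lt_trans (cone_exp_lt cone_exp0 ac a0).
by rewrite -a0 in ac; rewrite (cone_exp_fun ac cone_exp0).
Qed.

Lemma cone_expMn n a c : cone_exp a c -> cone_exp (a *+ n) (c ^+ n).
Proof.
move=> ac; elim: n => [|n IHn]; first exact: cone_exp0.
by rewrite mulrS exprS; exact: cone_expD.
Qed.

End ConeExponential.

(** * The natural valuation, and complements of the rationals *)

Section NaturalValuation.
Variable R : rcfType.
Implicit Types a x y z : R.

Lemma arch_equiv_sym x y : arch_equiv x y -> arch_equiv y x.
Proof. by move=> [n []]; exists n. Qed.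

Lemma arch_equiv_trans x y z :
  arch_equiv x y -> arch_equiv y z -> arch_equiv x z.
Proof.
move=> [n [yx xy]] [m [zy yz]]; exists (n * m)%N; split.
- by rewrite mulrnA (le_trans zy)// lerMn2r yx orbT.
- by rewrite mulnC mulrnA (le_trans xy)// lerMn2r yz orbT.
Qed.

Lemma nat_val_eqP x y : nat_val x = nat_val y <-> arch_equiv x y.
Proof.
split=> [xy|xy].
  have : nat_val y y by exists 1%N; rewrite mulr1n.
  by rewrite -xy.
apply/seteqP; split=> z /=; apply: arch_equiv_trans => //.
exact: arch_equiv_sym.
Qed.

Lemma val_ringP a : val_ring a <-> exists n : nat, `|a| <= n%:R.
Proof.
split=> [[a1|/nat_val_eqP[n [_]]]|[n an]].
- by exists 1%N; have := a1 1%N; rewrite mulr1n normr1 => /ltW.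
- by rewrite normr1; exists n.
(* If [a] is not infinitesimal, some [m] satisfies [1 <= |a| *+ m]; then [m + n] serves for both
   halves of the equivalence with 1. *)
- have [a1|/existsNP[m /negP]] := pselect (nat_val_lt 1 a); first by left.
  rewrite -leNgt => am; right; apply/nat_val_eqP; exists (m + n)%N; split.
    by rewrite (le_trans am)// ler_wpMn2l// leq_addr.
  by rewrite normr1 (le_trans an)// ler_nat leq_addl.
Qed.

Lemma pos_unitsP a : pos_units a <->
  0 < a /\ exists n : nat, a <= n%:R /\ a^-1 <= n%:R.
Proof.
split=> -[a0 b]; have aE := gtr0_norm a0; split=> //.
  have /nat_val_eqP[n []] := b; rewrite normr1 aE => + an.
  by rewrite -mulr_natl -ler_pdivrMr// div1r; exists n.
have [n [an an']] := b; apply/nat_val_eqP; exists n; rewrite normr1 aE an.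
by rewrite -mulr_natl -ler_pdivrMr// div1r.
Qed.

(** Rational subspaces, with the empty set also allowed: the union of an empty chain then causes no
    trouble in Zorn's lemma. *)
Definition rat_closed (S : set R) : Prop :=
  forall (q : rat) x y, S x -> S y -> S (ratr q * x + y).

(* A maximal subspace of [W] avoiding [1] is a complement of the rationals. *)
Lemma rat_complement (W : set R) : rat_closed W -> W 1 ->
  exists A : set R, [/\ A `<=` W, rat_closed A, A 0, ~ A 1 &
    forall x, W x -> exists2 a, A a & exists q, x = a + ratr q].
Proof.
move=> WC W1.
pose P S := [/\ S `<=` W, rat_closed S & ~ S 1].
have [F FP Ftot|A [[AW AC A1] Amax]] := @Zorn_bigcup _ P.
  split=> [x [S /FP[SW _ _] /SW]//| |[S /FP[]//]].
  move=> q x y [S FS Sx] [T FT Ty].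
  have [ST|TS] := Ftot _ _ FS FT.
  - by exists T => //; have [_ + _] := FP _ FT; apply=> //; exact: ST.
  - by exists S => //; have [_ + _] := FP _ FS; apply=> //; exact: TS.
have W0 : W 0 by have := WC (-1) _ _ W1 W1; rewrite rmorphN1 mulN1r addNr.
(* A maximal [A] cannot be empty, since the zero subspace would be strictly larger. *)
have A0 : A 0.
  have [[a Aa]|Aemp] := pselect (exists a, A a).
    by have := AC (-1) _ _ Aa Aa; rewrite rmorphN1 mulN1r addNr.
  exfalso; apply: (Amax [set 0]).
    split=> [x Ax|/(_ 0 erefl) A0]; first by exfalso; apply: Aemp; exists x.
    by apply: Aemp; exists 0.
  split=> [x ->//|q x y /= -> ->|/= /eqP]; first by rewrite mulr0 addr0.
  by rewrite oner_eq0.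
exists A; split=> // x Wx.
have [Ax|nAx] := pselect (A x).
  by exists x => //; exists 0; rewrite rmorph0 addr0.
(* [S] is the span of [A] and [x]. It properly contains [A], so by maximality it contains 1; solving
   [1 = a + q x] for [x] gives the decomposition, with [q] non-zero because 1 is not in [A]. *)
pose S : set R := [set y | exists2 a, A a & exists q, y = a + ratr q * x].
have [a Aa [q xq]] : exists2 a, A a & exists q, 1 = a + ratr q * x.
  apply: contrapT => nS1; apply: (Amax S).
    split=> [y Ay|/(_ x) AS].
      by exists y => //; exists 0; rewrite rmorph0 mul0r addr0.
    by apply/nAx/AS; exists 0 => //; exists 1; rewrite rmorph1 mul1r add0r.
  split=> //.
    by move=> _ [a /AW Wa [q ->]]; rewrite addrC; exact: WC.
  move=> q _ _ [a Aa [s ->]] [b Ab [t ->]].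
  exists (ratr q * a + b); first exact: AC.
  by exists (q * s + t); rewrite rmorphD rmorphM/=; ring.

have q0 : ratr q != 0 :> R.
  by apply: contra_not_neq A1 => q0; rewrite xq q0 mul0r addr0.
exists (ratr (- q^-1) * a + 0); first exact: AC.
exists q^-1; apply: (mulfI q0).
have -> : ratr q * x = 1 - a by rewrite xq addrC addKr.
by rewrite rmorphN fmorphV/=; field.
Qed.

End NaturalValuation.

(** * Roots, and exponentiation on the divisible hull *)

Lemma exists_rcf_root (R : rcfType) (x : R) n :
  0 < x -> exists2 y, 0 < y & y ^+ n.+1 = x.
Proof.
move=> x0; have x1 : 1 <= x + 1 by rewrite lerDr ltW.
(* The endpoint [x + 1] is at least 1, so its power is at least [x + 1] and the polynomial is
   non-negative there. *)
have [||y /andP[y0 _]] := @poly_ivt R ('X^(n.+1) - x%:P) 0 (x + 1).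
- exact: le_trans x1.
- rewrite !hornerE expr0n sub0r oppr_le0 ltW//= subr_ge0.
  by rewrite (le_trans _ (ler_eXnr _ x1))// lerDl.
rewrite rootE !hornerE subr_eq0 => /eqP yx; exists y => //.
rewrite lt_def y0 andbT; apply: contraTneq x0 => y_eq0.
by rewrite -yx y_eq0 expr0n ltxx.
Qed.

Section HullExponential.
Variables (R : rcfType) (Z : set R) (HZ : discrete_subring Z).
Hypothesis floorZ : forall r : R, exists2 z, z \in Z & z <= r < z + 1.
Variable E : aform.
Hypothesis HE : exp_formula E.
Hypothesis ME : models (nonneg_cone HZ) (IDelta0_EXP E).

Local Notation cexp := (cone_exp HZ E).

(* [y = 2 ^ x] for [x] in the divisible hull of [Z]: here [x = (a - b) / n.+1]
   and [y] is the positive [n.+1]-st root of [2 ^ a / 2 ^ b]. *)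
Definition hull_exp (x y : R) : Prop :=
  0 < y /\ exists n a b c d,
    [/\ cexp a c, cexp b d, x *+ n.+1 = a - b & y ^+ n.+1 = c / d].

Lemma hull_exp_cone a c : cexp a c -> hull_exp a c.
Proof.
move=> ac; split; first exact: (cone_exp_gt0 HE ME ac).
exists 0%N, a, 0, c, 1; split=> //; first exact: cone_exp0.
- by rewrite subr0.
- by rewrite divr1.
Qed.

Lemma hull_expD x y x' y' :
  hull_exp x y -> hull_exp x' y' -> hull_exp (x + x') (y * y').
Proof.
move=> [y0 [n [a [b [c [d [ac bd xab ycd]]]]]]].
move=> [y'0 [m [a' [b' [c' [d' [ac' bd' xab' ycd']]]]]]].
split; first exact: mulr_gt0.
(* Fractions are added over a common denominator; the predecessor compensates for the successor
   built into [hull_exp]. *)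
exists (n.+1 * m.+1).-1%N, (a *+ m.+1 + a' *+ n.+1), (b *+ m.+1 + b' *+ n.+1),
  (c ^+ m.+1 * c' ^+ n.+1), (d ^+ m.+1 * d' ^+ n.+1).
have G u v k := @cone_expMn _ _ HZ _ HE ME k u v.
split; [by apply: (cone_expD HE ME); apply: G..| |].
- rewrite prednK// mulrnDl mulrnA xab mulnC mulrnA xab' !mulrnBl.
  by rewrite opprD addrACA.
- rewrite prednK// exprMn exprM ycd mulnC exprM ycd' !expr_div_n.
  by rewrite invfM mulrACA.
Qed.

Lemma hull_expN x y : hull_exp x y -> hull_exp (- x) y^-1.
Proof.
move=> [y0 [n [a [b [c [d [ac bd xab ycd]]]]]]].
split; first by rewrite invr_gt0.
exists n, b, a, d, c; split=> //.
- by rewrite mulNrn xab opprB.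
- by rewrite exprVn ycd invf_div.
Qed.

Lemma hull_expB x y x' y' :
  hull_exp x y -> hull_exp x' y' -> hull_exp (x - x') (y / y').
Proof. by move=> xy /hull_expN; exact: hull_expD. Qed.

Lemma hull_exp01 : hull_exp 0 1.
Proof. exact/hull_exp_cone/cone_exp0. Qed.

Lemma hull_exp1 : hull_exp 1 2.
Proof. exact/hull_exp_cone/cone_exp1. Qed.

Lemma hull_exp_gt1 x y : hull_exp x y -> 0 < x -> 1 < y.
Proof.
move=> [y0 [n [a [b [c [d [ac bd xab ycd]]]]]]] x0.
rewrite -(@expr_gt1 _ n.+1)// ?ltW// ycd ltr_pdivlMr ?mul1r.
  by apply: (cone_exp_lt HE ME bd ac); rewrite -subr_gt0 -xab pmulrn_lgt0.
exact: (cone_exp_gt0 HE ME bd).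
Qed.

Lemma hull_exp_lt x y x' y' :
  hull_exp x y -> hull_exp x' y' -> x < x' -> y < y'.
Proof.
move=> xy xy' xx'; have y0 := proj1 xy.
have := hull_exp_gt1 (hull_expB xy' xy).
by rewrite subr_gt0 ltr_pdivlMr// mul1r; apply.
Qed.

(** The quotient [y / y'] is an exponential of 0, represented with [a = b], hence [c = d]; so some
    power of this positive quotient is 1. Thus the value does not depend on the chosen fraction. *)
Lemma hull_exp_fun x y y' : hull_exp x y -> hull_exp x y' -> y = y'.
Proof.
move=> xy xy'; have y'0 := proj1 xy'.
have [z0 [n [a [b [c [d [ac bd xab ycd]]]]]]] := hull_expB xy xy'.
have dc : d = c.
  move: xab; rewrite subrr mul0rn => /esym/eqP; rewrite subr_eq0 => /eqP ab.
  by rewrite ab in ac; exact: (cone_exp_fun HE ME bd ac).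
have d0 : d != 0 by rewrite gt_eqF// (cone_exp_gt0 HE ME bd).
by apply/divr1_eq/eqP; rewrite -(@pexpr_eq1 _ _ n.+1) ?ltW// ycd dc divff -?dc.
Qed.

Lemma hull_expMn n x y : hull_exp x y -> hull_exp (x *+ n) (y ^+ n).
Proof.
move=> xy; elim: n => [|n IHn]; first exact: hull_exp01.
by rewrite mulrS exprS; exact: hull_expD.
Qed.

Lemma hull_exp_divn n x y :
  hull_exp x y -> exists y', hull_exp (x / n.+1%:R) y'.
Proof.
move=> [y0 [m [a [b [c [d [ac bd xab ycd]]]]]]].
have [y' y'0 y'y] := exists_rcf_root n y0.
exists y'; split=> //; exists (n.+1 * m.+1).-1%N, a, b, c, d; split=> //.
- by rewrite prednK// mulrnA -[_ *+ n.+1]mulr_natr divfK// pnatr_eq0.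
- by rewrite prednK// exprM y'y.
Qed.

Lemma hull_exp_rat (q : rat) x y :
  hull_exp x y -> exists y', hull_exp (ratr q * x) y'.
Proof.
move=> xy; have [k kq] := denqP q.
have [z xz] : exists z, hull_exp ((numq q)%:~R * x) z.
  case: (numq q) => n.
    by exists (y ^+ n); rewrite mulr_natl; exact: hull_expMn.
  exists (y ^+ n.+1)^-1; rewrite NegzE mulrNz mulNr mulr_natl.
  exact/hull_expN/hull_expMn.
by rewrite /ratr kq mulrAC; exact: hull_exp_divn xz.
Qed.

(** The numerator [a - b] lies in [Z] and is finite, hence is a standard integer up to sign by
    discreteness. *)
Lemma hull_exp_rational x y n :
  hull_exp x y -> `|x| <= n%:R -> exists q, x = ratr q.
Proof.
move=> [_ [k [a [b [c [d [ac bd xab _]]]]]]] xn.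
have /andP[Za _] := cone_exp_dom ac; have /andP[Zb _] := cone_exp_dom bd.
have Zab : a - b \in Z by exact: discrete_subringB.
have abn : `|a - b| <= (n * k.+1)%:R.
  by rewrite -xab normrMn natrM mulr_natr lerMn2r xn orbT.
have [m abm] : exists m : nat, `|a - b| = m%:R.
  apply: (discrete_subring_nat HZ (n := (n * k.+1)%N)).
    by case: ger0P => // _; rewrite discrete_subringN.
  by rewrite normr_ge0.
have -> : x = (a - b) / k.+1%:R.
  by rewrite -xab -[x *+ _]mulr_natr mulfK// pnatr_eq0.
rewrite (numEsign (a - b)) abm.
exists ((-1) ^+ (a - b < 0)%R * m%:R / k.+1%:R).
by rewrite fmorph_div/= rmorphM/= rmorph_sign !ratr_nat.
Qed.

Lemma hull_exp_floor r : exists x y, hull_exp x y /\ x <= r < x + 1.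
Proof.
have [z Zz zr] := floorZ r; have [z0|/ltW z0] := lerP 0 z.
  have [c zc] := cone_exp_ex HE ME Zz z0.
  by exists z, c; split=> //; exact: hull_exp_cone.
have [||c zc] := cone_exp_ex HE ME (a := - z).
- exact: discrete_subringN.
- by rewrite oppr_ge0.
exists z, c^-1; split=> //.
by rewrite -[z]opprK; exact/hull_expN/hull_exp_cone.
Qed.

Lemma hull_exp_log_ge1 r : 1 <= r ->
  exists x y, hull_exp x y /\ y <= r < 2 * y.
Proof.
move=> r1; have [z Zz /andP[zr rz]] := floorZ r.
have z1 : 1 <= z.
  apply: (discrete_subring_ge1 HZ Zz).
  by rewrite -(ltrD2r 1) add0r (le_lt_trans r1).
have [a [c [ac Zc cz zc]]] := cone_exp_log HE ME Zz z1.
exists a, c; split; first exact: hull_exp_cone.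
(* The bound [z < 2 * c] holds between elements of [Z], so discreteness improves it to
   [z + 1 <= 2 * c], which dominates [r]. *)
rewrite (le_trans cz)//= (lt_le_trans rz)//.
apply: (discrete_subring_succ HZ) => //.
by rewrite mulr_natl; exact: discrete_subringD.
Qed.

Lemma hull_exp_log r : 0 < r -> exists x y, hull_exp x y /\ y <= r <= 2 * y.
Proof.
move=> r0; have [r1|/ltW r1] := lerP 1 r.
  have [x [y [xy /andP[yr /ltW ry]]]] := hull_exp_log_ge1 r1.
  by exists x, y; rewrite yr.
have [|x [y [xy /andP[yr /ltW ry]]]] := @hull_exp_log_ge1 r^-1.
  by rewrite invf_ge1.
have y0 := proj1 xy.
(* Inverting [y <= r^-1 <= 2 * y] places [r] between [(2 * y)^-1] and twice that value, whose
   exponent is [- (1 + x)]. Inversion exchanges the two ends, which is why the upper bound is stated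
   non-strictly. *)
exists (- (1 + x)), (2 * y)^-1; split.
  exact/hull_expN/hull_expD/xy/hull_exp1.
have -> : 2 * (2 * y)^-1 = y^-1 by rewrite invfM mulrA divff ?pnatr_eq0// mul1r.
by rewrite invf_ple ?posrE ?mulr_gt0// ry invf_pge ?posrE.
Qed.

(** * The exponential as a function on the hull *)

Definition hull_dom : set R := [set x | exists y, hull_exp x y].

Definition hull_pow (x : R) : R := xget 1 (hull_exp x).

Lemma hull_powP x : hull_dom x -> hull_exp x (hull_pow x).
Proof. exact: xgetPex. Qed.

Lemma hull_powE x y : hull_exp x y -> hull_pow x = y.
Proof.
move=> xy; exact: (hull_exp_fun (hull_powP (ex_intro _ y xy)) xy).
Qed.

Lemma hull_pow_gt0 x : hull_dom x -> 0 < hull_pow x.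
Proof. by move=> /hull_powP[]. Qed.

Lemma hull_dom_rat_closed : rat_closed hull_dom.
Proof.
move=> q x y [x' xx'] [y' yy']; have [z xz] := hull_exp_rat q xx'.
by exists (z * y'); exact: hull_expD.
Qed.

Lemma hull_domN x : hull_dom x -> hull_dom (- x).
Proof. by case=> y /hull_expN; exists y^-1. Qed.

Lemma hull_dom1 : hull_dom 1.
Proof. by exists 2; exact: hull_exp1. Qed.

Lemma hull_dom_ratr q : hull_dom (ratr q).
Proof. by have [y] := hull_exp_rat q hull_exp1; rewrite mulr1; exists y. Qed.

Lemma hull_powD x y : hull_dom x -> hull_dom y ->
  hull_pow (x + y) = hull_pow x * hull_pow y.
Proof. by move=> /hull_powP xx /hull_powP yy; exact/hull_powE/hull_expD. Qed.

Lemma hull_powN x : hull_dom x -> hull_pow (- x) = (hull_pow x)^-1.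
Proof. by move=> /hull_powP xx; exact/hull_powE/hull_expN. Qed.

Lemma hull_powMn x n : hull_dom x -> hull_pow (x *+ n) = hull_pow x ^+ n.
Proof. by move=> /hull_powP xx; exact/hull_powE/hull_expMn. Qed.

Lemma hull_powMz x (k : int) : hull_dom x -> hull_pow (x *~ k) = hull_pow x ^ k.
Proof.
move=> xW; case: k => n; first exact: hull_powMn.
rewrite NegzE mulrNz -exprnN -hull_powMn//; apply: hull_powN.
by exists (hull_pow x ^+ n.+1); exact/hull_expMn/hull_powP.
Qed.

Lemma hull_pow_lt x y : hull_dom x -> hull_dom y -> x < y ->
  hull_pow x < hull_pow y.
Proof. by move=> /hull_powP xx /hull_powP; exact: hull_exp_lt. Qed.

Lemma hull_pow_le x y : hull_dom x -> hull_dom y ->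
  (hull_pow x <= hull_pow y) = (x <= y).
Proof.
move=> xW yW; apply/idP/idP; last first.
  by rewrite le_eqVlt => /predU1P[->//|xy]; exact/ltW/hull_pow_lt.
by apply: contraTT; rewrite -!ltNge; exact: hull_pow_lt.
Qed.

(** The growth bound that, with monotonicity, turns a finite bound on [2 ^ x] into one on [x]. *)
Lemma hull_pow_nat_ge n : n%:R <= hull_pow n%:R.
Proof.
by rewrite (hull_powE (hull_expMn n hull_exp1)) -natrX ler_nat ltnW// ltn_expl.
Qed.

Lemma hull_dom_nat n : hull_dom n%:R.
Proof. by rewrite -(ratr_nat R n); exact: hull_dom_ratr. Qed.

Lemma hull_pow_le_nat x n : hull_dom x -> hull_pow x <= n%:R -> x <= n%:R.
Proof.
move=> xW xn; rewrite -hull_pow_le//; last exact: hull_dom_nat.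
exact: le_trans (hull_pow_nat_ge n).
Qed.

Lemma hull_pow_le_exp2 x n :
  hull_dom x -> x <= n%:R -> hull_pow x <= (2 ^ n)%:R.
Proof.
move=> xW xn; rewrite natrX -(hull_powE (hull_expMn n hull_exp1)).
by rewrite hull_pow_le//; exact: hull_dom_nat.
Qed.

Lemma ratr_bound (q : rat) : exists n : nat, `|ratr q : R| <= n%:R.
Proof.
(* The denominator is at least 1, so the numerator bounds the fraction. *)
have [k kq] := denqP q; exists `|numq q|%N.
rewrite /ratr kq normrM normfV normr_nat ler_pdivrMr// natr_absz intr_norm.
by rewrite ler_peMr// ler1n.
Qed.

(** * The left exponential on a rational complement *)

Lemma hull_left_exponential : admits_left_exponentiation R.
Proof.
have [A [AW AC A0 A1 AQ]] := rat_complement hull_dom_rat_closed hull_dom1.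
have AZ (q : rat) x : A x -> A (ratr q * x).
  by move=> Ax; rewrite -[ratr q * x]addr0; exact: AC.
have AB x y : A x -> A y -> A (x - y).
  by move=> Ax Ay; rewrite addrC -mulN1r -(rmorphN1 (@ratr R)); exact: AC.
(* A finite element of [A] is rational; were it non-zero, rescaling it would put 1 in [A]. *)
have Abnd a n : A a -> `|a| <= n%:R -> a = 0.
  move=> Aa an; have [q aq] := hull_exp_rational (hull_powP (AW _ Aa)) an.
  have [->//|a0] := eqVneq a 0; exfalso; apply: A1.
  have := AZ q^-1 _ Aa; rewrite fmorphV/= -aq mulVf//.
have powB x y : A x -> A y -> hull_pow (x - y) = hull_pow x / hull_pow y.
  move=> /AW Wx /AW Wy; rewrite hull_powD ?hull_powN//.
  exact: hull_domN.
have powinj : {in A &, injective hull_pow}.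
  move=> x y; rewrite !inE => /AW Wx /AW Wy xy.
  apply/le_anti.
  by rewrite -[x <= y]hull_pow_le// -[y <= x]hull_pow_le// xy lexx.
exists A, (hull_pow @` A), hull_pow; split; last 3 first.
- exact: inj_bij.
- by move=> x y; rewrite !inE => /AW Wx /AW Wy; exact: hull_powD.
- by move=> x y; rewrite !inE => /AW Wx /AW Wy; exact: hull_pow_lt.
- split.
  + by split=> [|x y]; rewrite !inE//; exact: AB.
  + by move=> q x; rewrite !inE; exact: AZ.
  + apply/seteqP; split=> [a [Aa /val_ringP[n /(Abnd _ _ Aa)]]//|_ ->].
    by split=> //; apply/val_ringP; exists 0%N; rewrite normr0.
  + apply/seteqP; split=> // r _.
    have [z [y [zy /andP[zr rz]]]] := hull_exp_floor r.
    have [a Aa [q zE]] := AQ z (ex_intro _ y zy).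
    exists a => //; exists (r - a); last by rewrite addrC subrK.
    (* With [z = a + q], the remainder [r - a] is [(r - z) + q]; the successor in [n.+1] accounts
       for [r - z], which lies in [[0, 1)]. *)
    have [n qn] := ratr_bound q; apply/val_ringP; exists n.+1.
    rewrite (_ : r - a = (r - z) + ratr q); last by rewrite zE; ring.
    rewrite (le_trans (ler_normD _ _))// -natr1 addrC lerD//.
    by rewrite ger0_norm ?subr_ge0// lerBlDl ltW.
- split.
  + split=> [_ [a Aa <-]|]; first exact/hull_pow_gt0/AW.
    split; first by rewrite inE; exists 0 => //; exact/hull_powE/hull_exp01.
    move=> x y; rewrite !inE => -[a Aa <-] [b Ab <-].
    by exists (a - b); [exact: AB|exact: powB].
  + move=> q x y; rewrite !inE => -[a Aa <-] [y0 yq].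
    have [Wa Aqa] := (AW _ Aa, AZ q _ Aa).
    exists (ratr q * a) => //; have [k kq] := denqP q.
    have z0 := hull_pow_gt0 (AW _ Aqa).
    (* Positive elements are compared through their powers of exponent [denq q], which here both
       equal [hull_pow (a *~ numq q)]. *)
    apply/eqP; rewrite -(@eqrXn2 _ k.+1) ?ltW// -hull_powMn; last exact: AW.
    move: yq; rewrite kq -exprnP => ->; rewrite -hull_powMz//.
    apply/eqP; congr hull_pow.
    rewrite -mulr_natr -mulrzr /ratr kq mulrAC mulrC.
    by field; rewrite nat1r pnatr_eq0.
  + apply/seteqP; split=> [_ [[a Aa <-] /pos_unitsP[_ [n [an an']]]]|_ ->].
      (* Bounds on [2 ^ a] and its inverse bound [a] and [- a], so [a] is finite and therefore 0. *)
      have Wa := AW _ Aa; rewrite (Abnd a n) ?(hull_powE hull_exp01)//.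
      rewrite ler_norml lerNl (hull_pow_le_nat Wa an) andbT.
      by apply: (hull_pow_le_nat (hull_domN Wa)); rewrite hull_powN.
    split; first by exists 0 => //; exact/hull_powE/hull_exp01.
    by apply/pos_unitsP; split=> //; exists 1%N; rewrite invr1.
  + apply/seteqP; split=> [_ [_ [a Aa <-] [u /pos_unitsP[u0 _] <-]]/=|r /= r0].
      by rewrite mulr_gt0// hull_pow_gt0//; exact: AW.
    have [z [y [zy /andP[yr ry]]]] := hull_exp_log r0.
    have [a Aa [q zE]] := AQ z (ex_intro _ y zy).
    have [n qn] := ratr_bound q.
    have Wa := AW _ Aa; have pa0 := hull_pow_gt0 Wa.
    exists (hull_pow a); first by exists a.
    exists (r / hull_pow a); last by rewrite mulrC divfK// gt_eqF.
    have Wq := hull_dom_ratr q; have pq0 := hull_pow_gt0 Wq.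
    have yE : y = hull_pow a * hull_pow (ratr q).
      by rewrite -hull_powD// -zE; exact/esym/hull_powE.
    apply/pos_unitsP; split; first exact: divr_gt0.
    (* Since [y = 2 ^ a * 2 ^ q], the unit [r / 2 ^ a] lies between [2 ^ q] and [2 * 2 ^ q]. As
       [|q| <= n], both [2 ^ q] and its inverse are at most [2 ^ n]; the extra factor 2 is the slack
       in [r <= 2 * y]. *)
    exists (2 * 2 ^ n)%N; split.
      rewrite ler_pdivrMr// (le_trans ry)// yE natrM -mulrA ler_wpM2l//.
      rewrite [leLHS]mulrC ler_wpM2r ?(ltW pa0)//.
      apply: (hull_pow_le_exp2 Wq).
      exact: le_trans (ler_norm _) qn.
    have qn' : (hull_pow (ratr q))^-1 <= (2 ^ n)%:R.
      rewrite -hull_powN//; apply: (hull_pow_le_exp2 (hull_domN Wq)).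
      by rewrite (le_trans _ qn)// -normrN ler_norm.
    rewrite invf_div ler_pdivrMr// (@le_trans _ _ ((2 ^ n)%:R * y))//.
      by rewrite yE mulrCA ler_peMr ?(ltW pa0)// -ler_pdivrMr// div1r.
    by rewrite ler_pM ?ler0n ?(ltW (proj1 zy))// ler_nat mul2n -addnn leq_addr.
Qed.

End HullExponential.

Theorem corollary12 (R : rcfType) (E : aform)
  (HE : exp_formula E)
  (HR : ~ Num.archimedean_axiom R)
  (HEXP : exists (Z : set R) (HZ : integer_part Z),
          models (nonneg_cone (proj1 HZ)) (IDelta0_EXP E)) :
  admits_left_exponentiation R.
Proof.
have [Z [HZ ME]] := HEXP.
exact: (hull_left_exponential (proj2 HZ) HE ME).
Qed.
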